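(* Let $(\mathfrak{R}h)(x) := x h(x) - h'(x) - x h''(x)$ and let $P_n := \mathfrak{R}^n \mathbf{1}$ for $n\ge 0$, where $\mathbf 1$ is the constant polynomial $1$. Then the family $\mathscr{P}=\{P_n : n\ge 0\}$ is the Sheffer sequence for the pair consisting of the delta series $f$ and the invertible series $g$ given by $$f(t)=\coth^{-1}\Big(\frac1t\Big), \qquad g(t)=\frac{1}{\sqrt{1-t^2}}.$$
   Context: Formal power series are taken over a field of characteristic zero (here $\mathbb{R}$). A delta series is a formal power series $f(t)=\sum_{k\ge 1} a_k t^k$ with $a_1\neq 0$; an invertible series is a formal power series $g(t)=\sum_{k\ge0} b_k t^k$ with $b_0\ne0$. A formal power series $h(t)=\sum_k h_k t^k$ acts as a linear functional on polynomials through $\langle t^k \mid x^n\rangle = n!\,\delta_{n,k}$, extended linearly. A sequence of polynomials $(s_n)_{n\ge0}$ with $\deg s_n=n$ is called the Sheffer sequence for the pair (delta series $f$, invertible series $g$) if $\langle g(t) f(t)^k \mid s_n(x)\rangle = n!\,\delta_{n,k}$ for all $n,k\ge0$; equivalently, if $$\frac{1}{g(\bar f(t))}\, e^{x\bar f(t)} = \sum_{n\ge 0} s_n(x)\frac{t^n}{n!},$$ where $\bar f$ is the compositional inverse of $f$. The series $\coth^{-1}(1/t)$ is understood as the formal power series $\sum_{k\ge 0}\frac{t^{2k+1}}{2k+1}$, and $\frac1{\sqrt{1-t^2}}$ as its Taylor series at $0$. *)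

(* Defs.v *)
From HB Require Import structures.
From mathcomp Require Import all_boot all_order all_algebra.
From mathcomp Require Import reals topology normedtype derive.

Set Implicit Arguments.
Unset Strict Implicit.
Unset Printing Implicit Defensive.

Import Order.TTheory GRing.Theory Num.Theory.
Import numFieldNormedType.Exports.

Local Open Scope ring_scope.

(* A formal power series is its sequence of coefficients: h stands for
   \sum_k (h k) t^k. The ring product of series is [fps_mul]; the product that
   functions into a ring inherit pointwise is not used. *)
Definition fps (F : fieldType) := nat -> F.

Definition fps_one (F : fieldType) : fps F := fun n => (n == 0%N)%:R.

Definition fps_mul (F : fieldType) (h1 h2 : fps F) : fps F :=
  fun n => \sum_(i < n.+1) h1 i * h2 (n - i)%N.

Definition fps_exp (F : fieldType) (h : fps F) (k : nat) : fps F :=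
  iter k (fps_mul h) (fps_one F).

Definition delta_series (F : fieldType) (f : fps F) : Prop :=
  f 0%N = 0 /\ f 1%N != 0.

Definition invertible_series (F : fieldType) (g : fps F) : Prop := g 0%N != 0.

(* < h | p >, extended linearly from < t^k | x^n > = n! if k = n, else 0. *)
Definition fps_pairing (F : fieldType) (h : fps F) (p : {poly F}) : F :=
  \sum_(n < size p) p`_n * (h n * n`!%:R).

(* Since [size] is the degree plus one, size (s n) = n.+1 says deg (s n) = n. *)
Definition is_sheffer (F : fieldType) (f g : fps F) (s : nat -> {poly F}) :
    Prop :=
  [/\ delta_series f,
      invertible_series g,
      forall n, size (s n) = n.+1 &
      forall n k,
        fps_pairing (fps_mul g (fps_exp f k)) (s n) =
        if n == k then n`!%:R else 0].

(* coth^-1 (1/t) = \sum_k t^(2k+1) / (2k+1) *)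
Definition arccoth_inv_series (F : fieldType) : fps F :=
  fun n => if odd n then n%:R^-1 else 0.

Definition taylor0 (R : realType) (u : R -> R) : fps R :=
  fun n => derive1n n u 0 / n`!%:R.

Definition inv_sqrt_series (R : realType) : fps R :=
  taylor0 (fun t : R => 1 / Num.sqrt (1 - t ^+ 2)).

Definition frakR (F : fieldType) (h : {poly F}) : {poly F} :=
  'X * h - h^`() - 'X * h^`(2).

Definition frakP (F : fieldType) (n : nat) : {poly F} := iter n (@frakR F) 1.

(* Main.v *)
Require Import Defs.
From mathcomp Require Import all_boot all_order all_algebra.
From mathcomp Require Import reals topology normedtype derive realfun ring.

(** The pairing turns multiplication by x into d/dt and d/dx into multiplication
by t, so the adjoint of h |-> x h - h' - x h'' is D : w |-> (1 - t^2) w' - t w.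
Since f' = 1 / (1 - t^2) and (1 - t^2) g' = t g, D (g f^k) = k g f^(k-1); hence
<g f^k | P_(n+1)> = k <g f^(k-1) | P_n>, and induction on n gives n! delta_nk.
*)

Set Implicit Arguments.
Unset Strict Implicit.
Unset Printing Implicit Defensive.

Import Order.TTheory GRing.Theory Num.Theory.
Import numFieldNormedType.Exports.

Local Open Scope ring_scope.

(** The terms [h'] and [x h''] contribute n+1 and (n+1)n times [p_(n+1)], which add up to the
    square. *)
Lemma coef_frakR (F : fieldType) (p : {poly F}) n :
  (frakR p)`_n = (if n == 0%N then 0 else p`_n.-1) - n.+1%:R ^+ 2 * p`_n.+1.
Proof.
rewrite /frakR !coefB !coefXM.
case: n => [|n] /=; first by rewrite coef_deriv expr1n mul1r subr0.
rewrite !coef_deriv; ring.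
Qed.

Lemma leq_size_frakR (F : fieldType) (p : {poly F}) :
  (size (frakR p) <= (size p).+1)%N.
Proof.
apply/leq_sizeP => -[//|n] /ltnSE le_pn.
by rewrite coef_frakR /= !nth_default ?mulr0 ?subr0 // (leq_trans le_pn) ?leqW.
Qed.

Lemma size_frakR (F : fieldType) (p : {poly F}) :
  p != 0 -> size (frakR p) = (size p).+1.
Proof.
move=> p0; apply/eqP; rewrite eqn_leq leq_size_frakR /=.
rewrite ltnNge; apply/negP => /leq_sizeP /(_ _ (leqnn _)).
rewrite coef_frakR size_poly_eq0 (negPf p0) [p`_ _.+1]nth_default //.
by rewrite mulr0 subr0 => /eqP; rewrite lead_coef_eq0 (negPf p0).
Qed.

Lemma size_frakP (F : fieldType) n : size (@frakP F n) = n.+1.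
Proof.
elim: n => [|n IHn]; first by rewrite size_poly1.
by rewrite /frakP iterS size_frakR -?size_poly_gt0 IHn.
Qed.

Lemma fps_pairing_wide (F : fieldType) (h : fps F) (p : {poly F}) N :
  (size p <= N)%N -> fps_pairing h p = \sum_(n < N) p`_n * (h n * n`!%:R).
Proof.
move=> le_pN; rewrite /fps_pairing.
rewrite (big_ord_widen N (fun n => p`_n * (h n * n`!%:R))) // big_mkcond.
by apply: eq_bigr => i _; case: ltnP => // /(nth_default 0) ->; rewrite mul0r.
Qed.

Lemma eq_fps_pairing (F : fieldType) (h1 h2 : fps F) (p : {poly F}) :
  h1 =1 h2 -> fps_pairing h1 p = fps_pairing h2 p.
Proof. by move=> eq_h; apply: eq_bigr => i _; rewrite eq_h. Qed.

Lemma fps_pairingZ (F : fieldType) (c : F) (h : fps F) (p : {poly F}) :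
  fps_pairing (fun n => c * h n) p = c * fps_pairing h p.
Proof. by rewrite /fps_pairing big_distrr; apply: eq_bigr => i _ /=; ring. Qed.

(** The series on the right is (1 - t^2) h' - t h; at n = 0 the junk value [h 0.-1] is multiplied by
    0. *)
Lemma fps_pairing_frakR (F : fieldType) (h : fps F) (p : {poly F}) :
  fps_pairing h (frakR p) =
  fps_pairing (fun n => n.+1%:R * h n.+1 - n%:R * h n.-1) p.
Proof.
set N := size p.
rewrite (fps_pairing_wide _ (leq_size_frakR p)).
rewrite (@fps_pairing_wide _ _ p N.+1) ?leqnSn //.
under eq_bigr do rewrite coef_frakR mulrBl.
under [RHS]eq_bigr do rewrite mulrBl mulrBr.
rewrite !sumrB; congr (_ - _).
  (* The two halves match after index shifts in opposite directions; the boundary terms vanish. *)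
  rewrite big_ord_recl mul0r add0r big_ord_recr /= [p`_N]nth_default //.
  rewrite mul0r addr0; apply: eq_bigr => i _.
  rewrite /bump /= add1n factS natrM; ring.
rewrite big_ord_recr [RHS]big_ord_recl /= [p`_N.+1]nth_default ?leqnSn //.
rewrite !(mul0r, mulr0, addr0, add0r); apply: eq_bigr => i _.
rewrite /bump /= add1n factS natrM; ring.
Qed.

(** Coefficient n of a product involves only coefficients up to n, so series may be truncated to
    polynomials, where [ring] and formal derivatives apply. *)
Lemma coef_fps_mul (F : fieldType) (h1 h2 : fps F) (p1 p2 : {poly F}) N n :
  (n < N)%N ->
  (forall i, (i < N)%N -> h1 i = p1`_i) ->
  (forall i, (i < N)%N -> h2 i = p2`_i) ->
  fps_mul h1 h2 n = (p1 * p2)`_n.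
Proof.
move=> lt_nN h1E h2E; rewrite coefM; apply: eq_bigr => i _.
rewrite h1E ?h2E //; first exact: leq_ltn_trans (leq_subr _ _) lt_nN.
exact: leq_trans (ltn_ord i) lt_nN.
Qed.

Lemma coef_fps_exp (F : fieldType) (h : fps F) (p : {poly F}) k N n :
  (forall i, (i < N)%N -> h i = p`_i) -> (n < N)%N ->
  fps_exp h k n = (p ^+ k)`_n.
Proof.
move=> hE; elim: k n => [|k IHk] n lt_nN; first by rewrite expr0 coef1.
by rewrite exprS; apply: coef_fps_mul lt_nN hE IHk.
Qed.

Lemma coef_one_sub_sqr_deriv (F : fieldType) (p : {poly F}) n :
  ((1 - 'X^2) * p^`())`_n = n.+1%:R * p`_n.+1 - n.-1%:R * p`_n.-1.
Proof.
rewrite mulrBl mul1r coefB coefXnM coef_deriv.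
case: n => [|[|n]] /=; [ring|ring|].
by rewrite subn2 coef_deriv /=; ring.
Qed.

(* The first two hypotheses are (1 - t^2) f' = 1 and, together with g 1 = 0,
   (1 - t^2) g' = t g. *)
Lemma sheffer_pair_recurrence (F : fieldType) (f g : fps F) k n :
  (forall i, i.+1%:R * f i.+1 - i.-1%:R * f i.-1 = (i == 0%N)%:R) ->
  (forall i, i.+2%:R * g i.+2 = i.+1%:R * g i) -> g 1%N = 0 ->
  n.+1%:R * fps_mul g (fps_exp f k) n.+1 - n%:R * fps_mul g (fps_exp f k) n.-1 =
  k%:R * fps_mul g (fps_exp f k.-1) n.
Proof.
move=> fE gE g1.
set f_ := \poly_(i < n.+2) f i; set g_ := \poly_(i < n.+2) g i.
have f_E i : (i < n.+2)%N -> f i = f_`_i by move=> ?; rewrite coef_poly ifT.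
have g_E i : (i < n.+2)%N -> g i = g_`_i by move=> ?; rewrite coef_poly ifT.
have gf_E j i : (i < n.+2)%N -> fps_mul g (fps_exp f j) i = (g_ * f_ ^+ j)`_i.
  by move=> lt_i; apply: coef_fps_mul lt_i g_E _ => l; apply: coef_fps_exp.
rewrite !gf_E // ?(leq_ltn_trans (leq_pred _)) //.
(* Truncation spoils the two differential equations only above degree n; such a defect stays
   invisible at degree n after multiplication. *)
have low (q r : {poly F}) :
    (forall i, (i <= n)%N -> q`_i = 0) -> (q * r)`_n = 0.
  move=> q0; rewrite coefM big1 // => i _.
  by rewrite q0 ?mul0r // -ltnS.
have Df : forall i, (i <= n)%N -> ((1 - 'X^2) * f_^`() - 1)`_i = 0.
  move=> i le_in; rewrite coefB coef_one_sub_sqr_deriv coef1.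
  rewrite -!f_E ?fE ?subrr //.
  by rewrite (leq_ltn_trans (leq_pred _)) // ltnS leqW.
have Dg : forall i, (i <= n)%N -> ((1 - 'X^2) * g_^`() - 'X * g_)`_i = 0.
  move=> i le_in; rewrite coefB coef_one_sub_sqr_deriv coefXM.
  case: i le_in => [|i] le_in.
    by rewrite -g_E // g1 /= mulr0 mul0r !subr0.
  have lt_in : (i < n.+2)%N by apply: leq_trans le_in _; rewrite leqW.
  by rewrite /= -!g_E // gE; ring.
(* The product rule, with the defects of both equations isolated. *)
have key : (1 - 'X^2) * (g_ * f_ ^+ k)^`() - 'X * (g_ * f_ ^+ k) =
  ((1 - 'X^2) * g_^`() - 'X * g_) * f_ ^+ k
  + ((1 - 'X^2) * f_^`() - 1) * (k%:R * g_ * f_ ^+ k.-1)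
  + k%:R * (g_ * f_ ^+ k.-1).
  rewrite derivM deriv_exp -mulr_natl; ring.
have := congr1 (fun q : {poly F} => q`_n) key.
rewrite coefB coef_one_sub_sqr_deriv coefXM.
rewrite !coefD (low _ _ Dg) (low _ _ Df) !add0r.
rewrite [in RHS]mulr_natl coefMn -[RHS]mulr_natl => <-.
by case: (n) => [|m] /=; ring.
Qed.

Lemma one_sub_sqr_gt0 (R : realType) (t : R) : `|t| < 1 -> 0 < 1 - t ^+ 2.
Proof. by move=> t1; rewrite subr_gt0 -real_normK ?num_real // expr_lt1. Qed.

Lemma is_derive_one_sub_sqr (R : realType) (t : R) :
  is_derive t 1 (fun x : R => 1 - x ^+ 2) (- (2 * t)).
Proof.
have -> : (fun x : R => 1 - x ^+ 2) = horner (1 - 'X^2).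
  by apply/boolp.funext => x; rewrite !hornerE.
by apply: is_derive_eq; rewrite !poly.derivE !hornerE; ring.
Qed.

Lemma is_derive_inv_sqrt (R : realType) (t : R) : `|t| < 1 ->
  is_derive t 1 (fun x : R => 1 / Num.sqrt (1 - x ^+ 2))
    (t / (1 - t ^+ 2) * (1 / Num.sqrt (1 - t ^+ 2))).
Proof.
move=> t1; have D0 := one_sub_sqr_gt0 t1.
have S0 : Num.sqrt (1 - t ^+ 2) != 0 by rewrite gt_eqF ?sqrtr_gt0.
have dS : is_derive t 1 (fun x : R => Num.sqrt (1 - x ^+ 2))
    ((2 * Num.sqrt (1 - t ^+ 2))^-1 * (- (2 * t))).
  apply: (@is_derive1_comp _ Num.sqrt (fun x : R => 1 - x ^+ 2)).
    exact: is_derive1_sqrt.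
  exact: is_derive_one_sub_sqr.
under boolp.eq_fun do rewrite div1r.
apply: is_derive_eq (is_deriveV (f := fun x => Num.sqrt (1 - x ^+ 2)) S0 dS) _.
(* The goal becomes rational in the square root. *)
rewrite /GRing.scale /= -[in t / _](sqr_sqrtr (ltW D0)).
by field.
Qed.

Lemma near_norm_lt1 (R : realType) (t : R) :
  `|t| < 1 -> \forall x \near t, `|x| < 1.
Proof.
by move=> t1; apply: (@cvgr_norm_lt _ _ _ (nbhs t) _ id t) => //; exact: cvg_id.
Qed.

(* The n-th derivative of (1 - t^2) u' = t u, with u = 1 / sqrt (1 - t^2); the
   junk value U 0.-1 at n = 0 is multiplied by 0. *)
Lemma derive1n_inv_sqrt (R : realType) (n : nat) (t : R) : `|t| < 1 ->
  let U k : R -> R := derive1n k (fun x : R => 1 / Num.sqrt (1 - x ^+ 2)) in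
  derivable (U n) t 1 /\
  (1 - t ^+ 2) * U n.+1 t = n.*2.+1%:R * (t * U n t) + n%:R ^+ 2 * U n.-1 t.
Proof.
move=> + U; elim/ltn_ind: n t => n IHn t t1.
have Dneq0 (x : R) : `|x| < 1 -> 1 - x ^+ 2 != 0.
  by move=> x1; rewrite gt_eqF // one_sub_sqr_gt0.
case: n IHn => [|n] IHn.
  have dU := is_derive_inv_sqrt t1; split; first by case: dU.
  rewrite /U derive1nS derive1E (@derive_val _ _ _ _ _ _ _ dU) !derive1n0.
  have := Dneq0 _ t1; set v := (1 / Num.sqrt _); move=> D0.
  by rewrite mul1r mulrAC; field.
have [dU UE] := IHn _ (ltnSn n) _ t1.
have isd m : derivable (U m) t 1 -> is_derive t 1 (U m) (U m.+1 t).
  by move=> d; rewrite /U derive1nS derive1E; exact: derivableP.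
(* [U n.-1] has derivative [U n] only for n > 0; at n = 0 the coefficient is 0. This term is why the
   induction is strong. *)
have isd' : is_derive t 1 (fun x => n%:R ^+ 2 * U n.-1 x) (n%:R ^+ 2 * U n t).
  case: n IHn {dU UE} => [|n] IHn.
    under boolp.eq_fun do rewrite expr0n mul0r.
    by rewrite expr0n mul0r; exact: is_derive_cst.
  apply: is_deriveZ; apply: isd; by have [] := IHn n (leqnSn _) _ t1.
pose A x := n.*2.+1%:R * (x * U n x) + n%:R ^+ 2 * U n.-1 x.
(* The induction hypothesis holds near t, so [U n.+1] is locally the quotient A / (1 - x^2) and can
   be differentiated as such. *)
have UE' : is_derive t 1 (U n.+1)
  ((n.*2.+3%:R * (t * U n.+1 t) + n.+1%:R ^+ 2 * U n t) / (1 - t ^+ 2)).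
  apply: (@near_eq_is_derive R R^o R^o (fun x : R => A x / (1 - x ^+ 2))).
    near=> x.
    have x1 : `|x| < 1 by near: x; exact: near_norm_lt1.
    have [_ AE] := IHn _ (ltnSn n) _ x1.
    by rewrite /A -AE mulrAC mulfV ?mul1r // Dneq0.
  have isd0 := isd _ dU.
  have dA : is_derive t 1 A
      (n.*2.+1%:R * (t * U n.+1 t + U n t) + n%:R ^+ 2 * U n t).
    apply: is_deriveD.
    have dM := is_deriveM (is_derive_id t 1) isd0.
    apply: is_derive_eq (is_deriveZ n.*2.+1%:R dM) _.
    by rewrite /GRing.scale /= mulr1.
  have dV := is_deriveV (f := fun x => 1 - x ^+ 2) (Dneq0 _ t1)
    (is_derive_one_sub_sqr t).
  apply: is_derive_eq (is_deriveM dA dV) _.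
  rewrite /GRing.scale /= /A.
  have D0 := Dneq0 _ t1.
  (* Differentiating the denominator raises 2n+1 to 2n+3, and (2n+1) + n^2 = (n+1)^2. *)
  rewrite -UE -[derive1 (U n) t]/(U n.+1 t) -muln2.
  by field.
split; first by case: UE'.
rewrite [U n.+2]derive1nS derive1E (@derive_val _ _ _ _ _ _ _ UE').
by rewrite [LHS]mulrC divfK ?Dneq0.
Unshelve. all: by end_near.
Qed.

Theorem theorem3p3 (R : realType) :
  is_sheffer (@arccoth_inv_series R) (@inv_sqrt_series R) (@frakP R).
Proof.
have n01 : `|0 : R| < 1 by rewrite normr0 ltr01.
(* At t = 0 the recurrence reads U_(i+2) = (i+1)^2 U_i; the factorials absorb one factor i+1. *)
have gE i : i.+2%:R * @inv_sqrt_series R i.+2 = i.+1%:R * @inv_sqrt_series R i.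
  have [_] := derive1n_inv_sqrt i.+1 n01.
  rewrite expr0n subr0 mul1r mul0r mulr0 add0r => UE.
  rewrite /inv_sqrt_series /taylor0 UE !factS !natrM.
  by field; rewrite !nat1r -natrD !pnatr_eq0 -lt0n fact_gt0.
have g0 : @inv_sqrt_series R 0 = 1.
  by rewrite /inv_sqrt_series /taylor0 derive1n0 expr0n subr0 sqrtr1 !divr1.
have g1 : @inv_sqrt_series R 1 = 0.
  have [_] := derive1n_inv_sqrt 0 n01.
  rewrite expr0n subr0 mul1r mul0r mulr0 addr0 => UE.
  by rewrite /inv_sqrt_series /taylor0 UE mul0r.
have fE i : i.+1%:R * @arccoth_inv_series R i.+1
    - i.-1%:R * @arccoth_inv_series R i.-1 = (i == 0%N)%:R.
  rewrite /arccoth_inv_series; case: i => [|i] /=.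
    by rewrite invr1 mulr1 mulr0 subr0.
  rewrite negbK; case: (boolP (odd i)) => odd_i; last by rewrite !mulr0 subr0.
  by rewrite !divff ?subrr // pnatr_eq0 // -lt0n odd_gt0.
split=> [||n|].
- by rewrite /delta_series /arccoth_inv_series /= invr1 oner_neq0.
- by rewrite /invertible_series g0 oner_neq0.
- exact: size_frakP.
elim=> [|n IHn] k.
  (* Pairing with 1 reads off the constant term of g f^k, which is 0 for k > 0 since f has none. *)
  rewrite /fps_pairing size_poly1 big_ord1 coef1 mul1r mulr1 /fps_mul big_ord1.
  rewrite g0 mul1r; case: k => [|k] //=.
  by rewrite /fps_mul big_ord1 mul0r.
rewrite /frakP iterS fps_pairing_frakR.
rewrite (eq_fps_pairing _ (fun i => sheffer_pair_recurrence k i fE gE g1)).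
(* For k = 0 the factor k kills the junk index [k.-1]; on the diagonal it turns n! into (n+1)!. *)
rewrite fps_pairingZ IHn; case: k => [|k] /=; first by rewrite mul0r.
rewrite eqSS; case: eqP => [->|]; last by rewrite mulr0.
by rewrite factS natrM.
Qed.
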